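(* Let $n=1$ and $H(x,y,p)=-f(x)-W(y)+\frac12p^2$ for $(x,y,p)\in\mathbb{R}\times\mathbb{T}\times\mathbb{R}$, where $f:\mathbb{R}\to\mathbb{R}$ is given by $f(x)=|x|$ if $|x|\le1$ and $f(x)=1$ if $|x|>1$, and $W:\mathbb{T}\to\mathbb{R}$ is given by $W(y)=\frac12-|y|$ for $y\in\left[-\frac12,\frac12\right]$ (extended $1$-periodically). Let $\overline{H}$ be the effective Hamiltonian of $H$. (i) Let $u^\epsilon$ be the unique viscosity solution to $$u^\epsilon_t+H\left(x,\frac{x}{\epsilon},Du^\epsilon\right)=0\ \text{ in }\mathbb{R}\times(0,\infty),\qquad u^\epsilon(x,0)=0\ \text{ on }\mathbb{R},$$ and let $u$ be the unique viscosity solution to $$u_t+\overline{H}(x,Du)=0\ \text{ in }\mathbb{R}\times(0,\infty),\qquad u(x,0)=0\ \text{ on }\mathbb{R}.$$ Then, for all $\epsilon\in(0,1)$ and all $t>0$, $$u^\epsilon(0,t)-u(0,t)\ge\frac12\epsilon t.$$ (ii) For $\lambda>0$, let $u^\epsilon$ be the unique viscosity solution to $\lambda u^\epsilon+H\left(x,\frac{x}{\epsilon},Du^\epsilon\right)=0$ in $\mathbb{R}$, and let $u$ be the unique viscosity solution to $\lambda u+\overline{H}(x,Du)=0$ in $\mathbb{R}$. Then, for all $\lambda,\epsilon\in(0,1)$, $$u^\epsilon(0)-u(0)\ge\frac{\epsilon}{2\lambda}.$$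
   Context: $\mathbb{T}=\mathbb{R}/\mathbb{Z}$; functions on $\mathbb{T}$ are identified with $1$-periodic functions on $\mathbb{R}$. Effective Hamiltonian: for each $(x,p)\in\mathbb{R}\times\mathbb{R}$, $\overline{H}(x,p)$ is the unique real constant for which the cell problem $H(x,y,p+Dv(y))=\overline{H}(x,p)$ for $y\in\mathbb{T}$ has a continuous (periodic) viscosity solution $v:\mathbb{T}\to\mathbb{R}$. Solutions are viscosity solutions. For the Cauchy problems they are unique in the class of functions that are bounded and uniformly continuous on $\mathbb{R}\times[0,T]$ for every $T>0$; for the static problems they are unique in the class of bounded uniformly continuous functions on $\mathbb{R}$. *)

(* Defs.v *)
From HB Require Import structures.
From mathcomp Require Import all_boot all_order all_algebra.
From mathcomp Require Import all_classical all_reals all_analysis.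
From mathcomp Require Import lra.

Set Implicit Arguments.
Unset Strict Implicit.
Unset Printing Implicit Defensive.

Import Order.TTheory GRing.Theory Num.Theory.
Import numFieldNormedType.Exports.

Local Open Scope classical_set_scope.
Local Open Scope ring_scope.

Section Viscosity.
Variables (R : realType) (V : normedModType R).

(* For finite-dimensional [V], the only case used below, continuity of every
   directional derivative is continuity of the differential. *)
Definition C1_on (Omega : set V) (phi : V -> R) : Prop :=
  forall z, Omega z ->
    differentiable phi z /\
    forall v : V, {for z, continuous (fun w => 'D_v phi w)}.

(* An equation F(z, u(z), Du(z)) = 0 is encoded by [F z r D], in which the
   gradient slot [D] is the linear form v |-> Du(z) v. *)
Definition viscosity_subsolution (Omega : set V)
    (F : V -> R -> (V -> R) -> R) (u : V -> R) : Prop :=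
  forall (phi : V -> R) (z : V), C1_on Omega phi -> Omega z ->
    (\forall w \near z, u w - phi w <= u z - phi z) ->
    F z (u z) (fun v => 'D_v phi z) <= 0.

Definition viscosity_supersolution (Omega : set V)
    (F : V -> R -> (V -> R) -> R) (u : V -> R) : Prop :=
  forall (phi : V -> R) (z : V), C1_on Omega phi -> Omega z ->
    (\forall w \near z, u z - phi z <= u w - phi w) ->
    0 <= F z (u z) (fun v => 'D_v phi z).

(* [Omega] is meant to be open. *)
Definition viscosity_solution (Omega : set V)
    (F : V -> R -> (V -> R) -> R) (u : V -> R) : Prop :=
  [/\ forall z, Omega z -> {for z, continuous u},
      viscosity_subsolution Omega F u &
      viscosity_supersolution Omega F u].

Definition bounded_unif_continuous_on (A : set V) (u : V -> R) : Prop :=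
  (exists M : R, forall z, A z -> `|u z| <= M) /\
  (forall e : R, 0 < e -> exists2 d : R, 0 < d &
     forall z w, A z -> A w -> `|z - w| < d -> `|u z - u w| < e).

End Viscosity.

Section HamiltonJacobi.
Variable R : realType.

(* Functions on the torus are 1-periodic functions on [R]. *)
Definition cell_solution (H : R -> R -> R -> R) (x p c : R) (v : R -> R) :
    Prop :=
  (forall y, v (y + 1) = v y) /\
  viscosity_solution setT (fun y _ D => H x y (p + D 1) - c) v.

Definition is_effective_hamiltonian (H : R -> R -> R -> R)
    (Hbar : R -> R -> R) : Prop :=
  forall x p c : R, (exists v, cell_solution H x p c v) <-> c = Hbar x p.

(* u_t + G(x, Du) = 0 in R x (0, oo), u(x, 0) = 0.  Points are pairs (x, t);
   the values of [u] at negative times are irrelevant. *)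
Definition cauchy_solution (G : R -> R -> R) (u : R * R -> R) : Prop :=
  [/\ viscosity_solution [set z : R * R | 0 < z.2]
        (fun z _ D => D (0, 1) + G z.1 (D (1, 0))) u,
      forall x, u (x, 0) = 0 &
      forall T : R, 0 < T ->
        bounded_unif_continuous_on [set z : R * R | 0 <= z.2 <= T] u].

(* lambda u + G(x, Du) = 0 in R. *)
Definition static_solution (lambda : R) (G : R -> R -> R) (u : R -> R) :
    Prop :=
  viscosity_solution setT (fun x r D => lambda * r + G x (D 1)) u /\
  bounded_unif_continuous_on setT u.

Definition slowpot (x : R) : R := if `|x| <= 1 then `|x| else 1.

(* [y - floor (y + 1/2)] is the representative of y mod 1 in [-1/2, 1/2). *)
Definition fastpot (y : R) : R :=
  2^-1 - `|y - (Num.floor (y + 2^-1))%:~R|.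

Lemma fastpot_periodic (y : R) : fastpot (y + 1) = fastpot y.
Proof.
rewrite /fastpot [y + 1 + 2^-1]addrAC floorDrz ?rpred1// floor1 intrD.
by rewrite opprD addrACA subrr addr0.
Qed.

Lemma fastpotE (y : R) : - 2^-1 <= y <= 2^-1 -> fastpot y = 2^-1 - `|y|.
Proof.
move=> /andP[y1 y2]; have [->|yn] := eqVneq y 2^-1.
  have h : (2^-1 + 2^-1 : R) = 1 by lra.
  rewrite /fastpot h floor1 distrC.
  by rewrite !ger0_norm; lra.
rewrite /fastpot (@floor_def _ _ 0) ?subr0//.
move: yn; rewrite neq_lt => /orP[]yl; last lra.
by apply/andP; split; lra.
Qed.

Definition hamiltonian (x y p : R) : R :=
  - slowpot x - fastpot y + 2^-1 * p ^+ 2.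

End HamiltonJacobi.

(* Main.v *)
(* Both Hamiltonians enter only through one-sided bounds.

   The effective Hamiltonian satisfies [Hbar x p >= - slowpot x >= - |x|], since
   the fast potential attains its minimum 0; hence a solution of the effective
   problem started from 0 does not grow at [x = 0], where [slowpot] vanishes.

   For [0 < eps < 1] the total potential satisfies
   [slowpot x + fastpot (x / eps) >= eps / 2]: for [|x| >= eps / 2] thanks to the
   slow part, and for [|x| <= eps / 2] because
   [|x| + 1 / 2 - |x| / eps = 1 / 2 - |x| (1 / eps - 1)].  Hence the oscillating
   solution grows at rate at least [eps / 2] up to the vanishing gradient term.

   Both growth bounds follow by touching the solution with a paraboloid in [x],
   narrow for the upper bound (so that the contact point is near 0), flat for the
   lower bound (so that its slope at the contact point is small). *)
Require Import Defs.
From mathcomp Require Import all_boot all_order all_algebra.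
From mathcomp Require Import all_classical all_reals all_analysis.
From mathcomp Require Import ring lra.

Set Implicit Arguments.
Unset Strict Implicit.
Unset Printing Implicit Defensive.

Import Order.TTheory GRing.Theory Num.Theory.
Import numFieldNormedType.Exports.

Local Open Scope classical_set_scope.
Local Open Scope ring_scope.

Section HamiltonJacobiBounds.
Variable R : realType.

(** * Differentiability and gradients of test functions *)

Lemma derive_comp (V : normedModType R) (f : V -> R) (g g' : R -> R) (z v : V) :
  differentiable f z -> is_derive (f z) (1 : R) g (g' (f z)) ->
  differentiable (g \o f) z /\ 'D_v (g \o f) z = 'D_v f z * g' (f z).
Proof.
move=> df dg.
have gd : differentiable g (f z) by apply/derivable1_diffP; exact: ex_derive.
split; first exact: differentiable_comp.
rewrite !deriveE//; last exact: differentiable_comp.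
by rewrite diff_comp//= diff1E//= derive1E derive_val.
Qed.

(** Space-time test functions are sums of a function of [x] and a function of [t]; the chain rule
    along the two projections reduces every directional derivative to one-variable ones. *)
Lemma C1_on_sep (g h g' h' : R -> R) :
  (forall x, is_derive x (1 : R) g (g' x)) ->
  (forall x, is_derive x (1 : R) h (h' x)) ->
  continuous g' -> continuous h' ->
  let phi := fun z : R * R => g z.1 + h z.2 in
  C1_on setT phi /\
  forall v z, 'D_v phi z = v.1 * g' z.1 + v.2 * h' z.2.
Proof.
move=> dg dh cg ch phi.
have d1 (z : R * R) : differentiable fst z.
  by apply: linear_differentiable => w; exact: cvg_fst.
have d2 (z : R * R) : differentiable snd z.
  by apply: linear_differentiable => w; exact: cvg_snd.
have D1 (v z : R * R) : 'D_v fst z = v.1 :> R.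
  by rewrite deriveE// diff_lin// => ?; exact: cvg_fst.
have D2 (v z : R * R) : 'D_v snd z = v.2 :> R.
  by rewrite deriveE// diff_lin// => ?; exact: cvg_snd.
have D v z : differentiable phi z /\ 'D_v phi z = v.1 * g' z.1 + v.2 * h' z.2.
  have [e1 E1] := derive_comp v (d1 z) (dg z.1).
  have [e2 E2] := derive_comp v (d2 z) (dh z.2).
  have -> : phi = (g \o fst) \+ (h \o snd) by [].
  split; first exact: differentiableD.
  by rewrite deriveD ?E1 ?E2 ?D1 ?D2//; exact: diff_derivable.
split=> [z _|v z]; last exact: (D v z).2.
split=> [|v]; first exact: (D 0 z).1.
have -> : (fun w => 'D_v phi w) = fun w => v.1 * g' w.1 + v.2 * h' w.2.
  by apply/funext => w; exact: (D v w).2.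
apply: cvgD; apply: cvgM; try exact: cvg_cst.
- by apply: continuous_comp; [exact: cvg_fst|exact: cg].
- by apply: continuous_comp; [exact: cvg_snd|exact: ch].
Qed.

Lemma C1_on_line (g g' : R -> R) :
  (forall x, is_derive x (1 : R) g (g' x)) -> continuous g' ->
  C1_on setT g /\ forall z, 'D_1 g z = g' z.
Proof.
move=> dg cg; split=> [z _|z]; last exact: derive_val.
split=> [|v]; first by apply/derivable1_diffP; exact: ex_derive.
have -> : (fun w => 'D_v g w) = fun w => v * g' w.
  apply/funext => w.
  have did : differentiable id w by exact: ex_diff.
  have [_] := derive_comp v did (dg w).
  by rewrite derive_id.
by apply: cvgM; [exact: cvg_cst|exact: cg].
Qed.

(** Serves the supersolution tests: touching [- u] from above by [phi] is touching [u] from below by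
    [- phi]. *)
Lemma C1_onN (V : normedModType R) (Omega : set V) (phi : V -> R) :
  C1_on setT phi -> C1_on Omega (fun z => - phi z) /\
  forall v z, 'D_v (fun z => - phi z) z = - 'D_v phi z.
Proof.
move=> C1; have D v z : 'D_v (fun z => - phi z) z = - 'D_v phi z.
  by rewrite deriveN//; apply: diff_derivable; exact: (C1 z I).1.
split=> // z _; split; first by apply: differentiableN; exact: (C1 z I).1.
move=> v.
have -> : (fun w => 'D_v (fun z => - phi z) w) = fun w => - 'D_v phi w.
  by apply/funext => w; exact: D.
by apply: cvgN; exact: (C1 z I).2.
Qed.

(** * Paraboloid barriers and their contact points *)

Definition parabola (eta a x : R) : R := eta * (x - a) ^+ 2.

Lemma parabola_C1 (eta a : R) : C1_on setT (parabola eta a) /\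
  forall z, 'D_1 (parabola eta a) z = 2 * eta * (z - a).
Proof.
apply: C1_on_line => [x|x].
  rewrite /parabola; apply: is_derive_eq.
  by rewrite /GRing.scale/=; ring.
apply: cvgM; first exact: cvg_cst.
by apply: cvgB; [exact: cvg_id|exact: cvg_cst].
Qed.

(** The exponential part equals [delta] at time [T] and, for nonnegative [delta] and [k], adds a
    nonnegative amount to the time slope [c]. *)
Definition barrier (eta c delta k T : R) (z : R * R) : R :=
  parabola eta 0 z.1 + (c * z.2 + delta * expR (k * (z.2 - T))).

Lemma barrier_C1 (eta c delta k T : R) :
  let phi := barrier eta c delta k T in
  [/\ C1_on setT phi,
      forall z, 'D_(1, 0) phi z = 2 * eta * z.1 &
      forall z, 'D_(0, 1) phi z = c + delta * k * expR (k * (z.2 - T))].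
Proof.
have := @C1_on_sep (parabola eta 0)
  (fun t => c * t + delta * expR (k * (t - T)))
  (fun x => 2 * eta * (x - 0)) (fun t => c + delta * k * expR (k * (t - T))).
case.
- move=> x; rewrite /parabola; apply: is_derive_eq.
  by rewrite /GRing.scale/=; ring.
- move=> t; have de : is_derive t (1 : R) (fun t => k * (t - T)) k.
    by apply: is_derive_eq; rewrite /GRing.scale/=; ring.
  have := is_derive1_comp (f := @expR R) (g := fun t => k * (t - T))
    (is_derive_expR _) de.
  rewrite /comp => dE.
  by apply: is_derive_eq; rewrite /GRing.scale/=; ring.
- move=> x; apply: cvgM; first exact: cvg_cst.
  by apply: cvgB; [exact: cvg_id|exact: cvg_cst].
- move=> t; apply: cvgD; first exact: cvg_cst.
  apply: cvgM; first exact: cvg_cst.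
  apply: (continuous_comp (f := fun t => k * (t - T)));
    last exact: continuous_expR.
  apply: cvgM; first exact: cvg_cst.
  by apply: cvgB; [exact: cvg_id|exact: cvg_cst].
move=> C D; split=> // z; rewrite D/=; ring.
Qed.

(* The exponential term of the barrier is [delta] at time [T] but exceeds the
   oscillation of [u] at time [2T], so that the maximum of [u - phi] over
   [0, 2T] is attained at an interior time. *)
Lemma barrier_touching (u : R * R -> R) (M T c delta eta : R) :
  0 < T -> 0 < delta -> 0 < eta ->
  (forall z, 0 <= z.2 <= 2 * T -> `|u z| <= M) ->
  {within [set z : R * R | 0 <= z.2], continuous u} ->
  (forall x, u (x, 0) = 0) ->
  c * T + delta < u (0, T) ->
  exists (k : R) (z : R * R), [/\ 0 <= k, 0 < z.2,
    eta * z.1 ^+ 2 <= M + 2 * T * `|c| &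
    let phi := barrier eta c delta k T in
    \forall w \near z, u w - phi w <= u z - phi z].
Proof.
move=> T0 d0 e0 uM cu u0 uT.
(* On the strip up to time [2 * T], [u z - c * z.2] is at most [B]. *)
set B := M + 2 * T * `|c|.
have M0 : 0 <= M.
  apply: le_trans (uM (0, 0) _); first exact: normr_ge0.
  by rewrite /= lexx mulr_ge0// ltW.
have B0 : 0 <= B by rewrite addr_ge0// !mulr_ge0// ltW.
(* Chosen so that [expR s >= 1 + s] with [s = k * T] makes the exponential term at least [B + delta]
   at time [2 * T]. *)
pose k := B / (delta * T).
have k0 : 0 <= k by rewrite divr_ge0// mulr_ge0// ltW.
pose r := B / eta + 1.
have Bz : 0 <= B / eta by rewrite divr_ge0// ltW.
have r0 : 0 < r by rewrite /r; lra.
have rB : B < eta * r ^+ 2.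
  have -> : B = eta * (B / eta) by rewrite mulrC divfK// gt_eqF.
  rewrite ltr_pM2l// /r; nra.
pose phi := barrier eta c delta k T.
pose K : set (R * R) := `[- r, r]%classic `*` `[0, 2 * T]%classic.
have KE z : K z = [/\ - r <= z.1, z.1 <= r, 0 <= z.2 & z.2 <= 2 * T] :> Prop.
  rewrite /K /setX/= !in_itv/=; apply/propext; split.
    by move=> [/andP[? ?] /andP[? ?]].
  by move=> [? ? ? ?]; split; apply/andP.
have [C1 D1 D2] := barrier_C1 eta c delta k T.
have cphi : {within K, continuous (u \- phi)}.
  move=> z; apply: cvgB.
    apply: (continuous_subspaceW _ cu) => w; rewrite KE => -[_ _ + _].
    by [].
  apply: (@continuous_subspaceT _ _ K phi) => w.
  by apply: differentiable_continuous; exact: (C1 w I).1.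
have K0 : K !=set0.
  by exists (0, T); rewrite KE/=; split; nra.
have cK : compact K by apply: compact_setX; exact: segment_compact.
have [z] := compact_EVT_max K0 cK cphi.
rewrite inE KE => -[z1 z2 z3 z4] zmax.
have phiT : phi (0, T) = c * T + delta.
  by rewrite /phi /barrier /parabola/= !subrr mulr0 expR0 expr0n/= mulr0; ring.
(* Positivity of the maximum, inherited from [(0, T)], keeps the contact point off every face of the
   box, since [phi] dominates [u] there. *)
have up : 0 < u z - phi z.
  have /zmax : (0, T) \in K by rewrite inE KE/=; split; nra.
  by apply: lt_le_trans; rewrite /= phiT; lra.
have uzM : u z <= M.
  by apply: le_trans (ler_norm _) (uM _ _); apply/andP.
have cz : - (c * z.2) <= 2 * T * `|c|.
  have := ler_norm (- c); rewrite normrN; have := normr_ge0 c; nra.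
have ez : 0 < delta * expR (k * (z.2 - T)) by rewrite mulr_gt0// expR_gt0.
have pz : 0 <= eta * z.1 ^+ 2 by rewrite mulr_ge0 ?sqr_ge0// ltW.
have phiE : phi z = eta * z.1 ^+ 2 + (c * z.2 + delta * expR (k * (z.2 - T))).
  by rewrite /phi /barrier /parabola subr0.
have zB : eta * z.1 ^+ 2 < B.
  by move: up; rewrite phiE /B; lra.
have z20 : 0 < z.2.
  rewrite lt_neqAle z3 andbT; apply/eqP => z20.
  move: up; rewrite phiE [z]surjective_pairing -z20 u0/= mulr0.
  move: ez pz; rewrite -z20; lra.
have z2T : z.2 < 2 * T.
  rewrite lt_neqAle z4 andbT; apply/eqP => z2T.
  have : B + delta <= delta * expR (k * (z.2 - T)).
    have := expR_ge1Dx (k * (z.2 - T)); rewrite -(ler_pM2l d0).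
    apply: le_trans; rewrite mulrDr mulr1 addrC lerD2l z2T.
    have -> : 2 * T - T = T by ring.
    by rewrite /k le_eqVlt; apply/orP; left; apply/eqP; field; rewrite !gt_eqF.
  by move: up; rewrite phiE /B; lra.
have zr : - r < z.1 < r.
  by rewrite -ltr_norml; rewrite -ltr_sqr ?qualifE/= ?normr_ge0 ?ltW//
    real_normK ?num_real// -(ltr_pM2l e0); lra.
exists k, z; split=> //; first exact: ltW.
move=> phi'.
have : nbhs z [set w : R * R | (- r < w.1 < r) /\ (0 < w.2 < 2 * T)].
  case/andP: zr => zr1 zr2.
  exists (`]- r, r[%classic, `]0, 2 * T[%classic) => /=.
    split; apply: near_in_itvoo; rewrite in_itv/=; exact/andP.
  by move=> [w1 w2]/=; rewrite !in_itv/=.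
apply: filterS => w [/andP[a1 a2] /andP[a3 a4]].
by apply: zmax; rewrite inE KE; split; exact: ltW.
Qed.

(** At the ends of the interval the penalty [eta * r ^+ 2] exceeds the oscillation bound [2 * M], so
    the maximum is attained inside. Comparison with the vertex [a] gives the first two
    conclusions. *)
Lemma parabola_touching (u : R -> R) (a r M eta : R) :
  0 < r -> 0 < eta -> 2 * M < eta * r ^+ 2 ->
  (forall x, a - r <= x <= a + r -> `|u x| <= M) ->
  continuous u ->
  exists z : R, [/\ eta * (z - a) ^+ 2 <= 2 * M,
    u a <= u z - parabola eta a z &
    \forall w \near z, u w - parabola eta a w <= u z - parabola eta a z].
Proof.
move=> r0 e0 rM uM cu.
have ar : a - r <= a + r by lra.
have cphi : {within `[a - r, a + r], continuous (u \- parabola eta a)}.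
  apply: continuous_subspaceT => w; apply: cvgB; first exact: cu.
  apply: differentiable_continuous.
  exact: ((parabola_C1 eta a).1 w I).1.
have [z zr zmax] := EVT_max ar cphi.
have az : u a <= u z - parabola eta a z.
  have := zmax a; rewrite in_itv/= /parabola subrr expr0n/= mulr0 subr0; apply.
  by apply/andP; split; lra.
have zM : eta * (z - a) ^+ 2 <= 2 * M.
  have := uM a; rewrite lerBlDr !lerDl ltW// => /(_ isT)/ler_normlP[ua _].
  have := uM z zr => /ler_normlP[_ uz].
  by move: az; rewrite /parabola; lra.
exists z; split=> //.
have {}zr : a - r < z < a + r.
  have : (z - a) ^+ 2 < r ^+ 2 by rewrite -(ltr_pM2l e0); lra.
  by move=> h; apply/andP; split; nra.
have /near_in_itvoo : z \in `]a - r, a + r[ by rewrite in_itv.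
apply: filterS => w /=; rewrite in_itv/= => /andP[w1 w2].
by apply: zmax; rewrite in_itv/=; apply/andP; split; exact: ltW.
Qed.

(** * Lower bounds on the potential and on the effective Hamiltonian *)

Lemma slowpot_le_norm (x : R) : slowpot x <= `|x|.
Proof. by rewrite /slowpot; case: ifPn => //; rewrite -ltNge => /ltW. Qed.

Lemma floor_half_bounds (y : R) :
  - 2^-1 <= y - (Num.floor (y + 2^-1))%:~R < 2^-1.
Proof.
have := floor_le (y + 2^-1); have := floorD1_gt (y + 2^-1).
by rewrite intrD => h1 h2; apply/andP; split; lra.
Qed.

Lemma fastpot_ge0 (y : R) : 0 <= fastpot y.
Proof.
have /andP[h1 h2] := floor_half_bounds y.
by rewrite /fastpot subr_ge0 ler_norml h1 ltW.
Qed.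

Lemma potential_ge (eps x : R) : 0 < eps < 1 ->
  eps / 2 <= slowpot x + fastpot (x / eps).
Proof.
move=> /andP[e0 e1]; have W0 := fastpot_ge0 (x / eps).
have [xe|xe] := leP (eps / 2) `|x|.
  by rewrite /slowpot; case: ifP => _; lra.
have ax : `|x| = eps * `|x / eps|.
  by rewrite normrM normfV (gtr0_norm e0) mulrC divfK// gt_eqF.
have y2 : `|x / eps| < 2^-1.
  by rewrite -(ltr_pM2l e0) -ax; lra.
(* With [y = x / eps], the main case amounts to [(1 - eps) * (1 / 2 - |y|) >= 0]. *)
rewrite fastpotE -?ler_norml ?ltW// /slowpot ax; case: ifPn => h; last nra.
nra.
Qed.

(* Arbitrarily close to [y = 1/2], where the fast potential vanishes, there are
   points at which a subsolution of the cell problem is touched from above. *)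
Lemma effective_hamiltonian_ge (Hbar : R -> R -> R) (x p : R) :
  is_effective_hamiltonian (@hamiltonian R) Hbar -> - slowpot x <= Hbar x p.
Proof.
move=> hH; set c := Hbar x p.
have [v [_ [cv sub _]]] : exists v, cell_solution (@hamiltonian R) x p c v.
  by apply/hH.
apply/ler_addgt0Pr => e e0.
have cv' : continuous v by move=> y; exact: cv.
have [M vM] : exists M, forall y, 2^-1 - 1 <= y <= 2^-1 + 1 -> `|v y| <= M.
  have h : 2^-1 - 1 <= 2^-1 + 1 :> R by lra.
  have cn : {within `[2^-1 - 1, 2^-1 + 1], continuous (fun y => `|v y|)}.
    apply: continuous_subspaceT => y.
    by apply: continuous_comp; [exact: cv'|exact: norm_continuous].
  have [y _ yM] := EVT_max h cn.
  by exists `|v y| => z zI; apply: yM; rewrite in_itv.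
have M0 : 0 <= M.
  by apply: le_trans (vM 2^-1 _); [exact: normr_ge0|apply/andP; split; lra].
(* The cap [2^-1] keeps the contact point in [(0, 1)], where [fastpot] is at most the distance to
   [1 / 2]. *)
pose d := Num.min e 2^-1.
have d0 : 0 < d by rewrite lt_min e0/=; lra.
have de : d <= e by rewrite /d ge_min lexx.
have d2 : d <= 2^-1 by rewrite /d ge_min lexx orbT.
pose eta := (2 * M + 1) / d ^+ 2.
have eta0 : 0 < eta by rewrite divr_gt0// ?exprn_gt0//; lra.
have etad : 2 * M < eta * d ^+ 2.
  by rewrite /eta divfK ?gt_eqF ?exprn_gt0//; lra.
have vMd y : 2^-1 - d <= y <= 2^-1 + d -> `|v y| <= M.
  by move=> /andP[y1 y2]; apply: vM; apply/andP; split; lra.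
have [z [zM _ zmax]] := parabola_touching d0 eta0 etad vMd cv'.
have [C1 D1] := parabola_C1 eta 2^-1.
have := sub _ z C1 I zmax; rewrite /hamiltonian.
have : (z - 2^-1) ^+ 2 < d ^+ 2 by rewrite -(ltr_pM2l eta0); lra.
move=> zd; have z1 : 2^-1 - d < z by nra.
have z2 : z < 2^-1 + d by nra.
have Wd : fastpot z <= d.
  have [zl|zl] := leP z 2^-1.
    rewrite fastpotE; last by apply/andP; split; lra.
    by have := ler_norm z; lra.
  rewrite -(subrK 1 z) fastpot_periodic fastpotE;
    last by apply/andP; split; lra.
  by have := ler_norm (- (z - 1)); rewrite normrN; lra.
(* Discarding the square, the subsolution inequality gives [c >= - slowpot x - fastpot z]. *)
by have := sqr_ge0 (p + 'D_1 (parabola eta 2^-1) z); lra.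
Qed.

(** * Growth of Cauchy solutions at the origin *)

Lemma cauchy_bounded_continuous (G : R -> R -> R) (u : R * R -> R) (T : R) :
  0 < T -> cauchy_solution G u ->
  (exists M, forall z, 0 <= z.2 <= T -> `|u z| <= M) /\
  {within [set z : R * R | 0 <= z.2], continuous u}.
Proof.
move=> T0 [_ _ buc]; split; first by have [[M uM] _] := buc T T0; exists M.
apply/subspace_continuousP => z z0.
(* Uniform continuity is given strip by strip; the strip of height [z.2 + 1] contains the points of
   nonnegative time at distance less than 1 from [z]. *)
have zT : 0 < z.2 + 1 by move: z0 => /=; lra.
have [_ uc] := buc _ zT.
apply/cvgrPdist_lt => e e0; have [d d0 du] := uc e e0.
rewrite near_withinE.
have d10 : 0 < Num.min d 1 by rewrite lt_min d0/=.
apply: filterS (nbhsx_ballx z _ d10) => w zw w0; apply: du.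
- by rewrite /= z0/=; lra.
- rewrite /= w0/=; case: zw => _; rewrite -ball_normE /ball_/= lt_min.
  by move=> /andP[_ /ltr_normlP[]]; lra.
- by move: zw; rewrite -ball_normE /ball_/= lt_min => /andP[].
Qed.

(** If [u (0, t)] exceeded [e], the subsolution inequality at the contact point would give
    [c <= - G <= |z.1| < c]. *)
Lemma cauchy_at0_le (G : R -> R -> R) (u : R * R -> R) (t : R) :
  (forall x p, - slowpot x <= G x p) -> cauchy_solution G u -> 0 < t ->
  u (0, t) <= 0.
Proof.
move=> HG su t0; have t20 : 0 < 2 * t by lra.
have [[M uM] cu] := cauchy_bounded_continuous t20 su.
have [[_ sub _] u0 _] := su.
apply/ler_addgt0Pr => e e0; rewrite add0r leNgt; apply/negP => ue.
have e20 : 0 < e / 2 by lra.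
pose c := e / (2 * t); have c0 : 0 < c by rewrite divr_gt0.
have ct : c * t + e / 2 = e by rewrite /c; field; rewrite gt_eqF.
pose B := M + 2 * t * `|c|.
have B0 : 0 <= B.
  apply: addr_ge0; last by rewrite !mulr_ge0// ltW.
  apply: le_trans (uM (0, t) _); first exact: normr_ge0.
  by apply/andP; split=> /=; lra.
(* Narrow enough to force [|z.1| < c] at the contact point. *)
pose eta := (B + 1) / c ^+ 2.
have eta0 : 0 < eta by rewrite divr_gt0// ?exprn_gt0//; lra.
have etac : eta * c ^+ 2 = B + 1 by rewrite /eta divfK// gt_eqF// exprn_gt0.
have [|k [z [k0 z0 zB zmax]]] :=
  barrier_touching t0 e20 eta0 uM cu u0 (c := c).
  by rewrite ct.
have [C1 _ Dt] := barrier_C1 eta c (e / 2) k t.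
have C1' : C1_on [set z : R * R | 0 < z.2] (barrier eta c (e / 2) k t).
  by move=> w _; exact: C1.
have := sub _ z C1' z0 zmax; rewrite Dt.
have := HG z.1 ('D_(1, 0) (barrier eta c (e / 2) k t) z).
have := slowpot_le_norm z.1.
have : 0 <= e / 2 * k * expR (k * (z.2 - t)).
  by rewrite !mulr_ge0// ?expR_ge0// ltW.
have : `|z.1| < c.
  rewrite -ltr_sqr ?qualifE/= ?normr_ge0 ?ltW// real_normK ?num_real//.
  by rewrite -(ltr_pM2l eta0) etac; move: zB; rewrite -/B; lra.
lra.
Qed.

(** The barrier touches [- u] from above. If the bound failed by [e], the supersolution inequality
    would give [d <= 2 * eta * (eta * z.1 ^+ 2) <= 2 * eta * B < d]. *)
Lemma cauchy_at0_ge (G : R -> R -> R) (u : R * R -> R) (m t : R) :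
  (forall x p, G x p <= 2^-1 * p ^+ 2 - m) -> cauchy_solution G u -> 0 < t ->
  m * t <= u (0, t).
Proof.
move=> HG su t0; have t20 : 0 < 2 * t by lra.
have [[M uM] cu] := cauchy_bounded_continuous t20 su.
have [[_ _ sup] u0 _] := su.
apply/ler_addgt0Pr => e e0; rewrite leNgt; apply/negP => ue.
have e20 : 0 < e / 2 by lra.
pose d := e / (2 * t); have d0 : 0 < d by rewrite divr_gt0.
(* [- c] is the rate [m] lowered by [d], which uses half of the slack [e] by time [t]; the
   exponential term takes the other half. *)
pose c := d - m.
have ct : c * t + e / 2 = e - m * t by rewrite /c /d; field; rewrite gt_eqF.
pose B := M + 2 * t * `|c|.
have B0 : 0 <= B.
  apply: addr_ge0; last by rewrite !mulr_ge0// ltW.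
  apply: le_trans (uM (0, t) _); first exact: normr_ge0.
  by apply/andP; split=> /=; lra.
pose eta := d / (2 * B + 1).
have eta0 : 0 < eta by rewrite divr_gt0//; lra.
have etac : eta * (2 * B + 1) = d by rewrite /eta divfK// gt_eqF//; lra.
have uM' z : 0 <= z.2 <= 2 * t -> `|(- u z)| <= M by rewrite normrN; exact: uM.
have cu' : {within [set z : R * R | 0 <= z.2], continuous (fun z => - u z)}.
  by move=> z; apply: cvgN; exact: cu.
have u0' x : - u (x, 0) = 0 by rewrite u0 oppr0.
have [|k [z [k0 z0 zB zmax]]] :=
  barrier_touching t0 e20 eta0 uM' cu' u0' (c := c).
  by rewrite ct; lra.
have [C1 Dx Dt] := barrier_C1 eta c (e / 2) k t.
set phi := barrier _ _ _ _ _ in C1 Dx Dt zmax.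
have [C1' dphi] := C1_onN [set z : R * R | 0 < z.2] C1.
have zmin : \forall w \near z, u z - - phi z <= u w - - phi w.
  by apply: filterS zmax => w; lra.
have := sup _ z C1' z0 zmin; rewrite !dphi Dt Dx.
have := HG z.1 (- (2 * eta * z.1)).
have : 0 <= e / 2 * k * expR (k * (z.2 - t)).
  by rewrite !mulr_ge0// ?expR_ge0// ltW.
rewrite -/B in zB.
have -> : 2^-1 * (- (2 * eta * z.1)) ^+ 2 = 2 * eta * (eta * z.1 ^+ 2) by field.
have : 2 * eta * (eta * z.1 ^+ 2) <= 2 * eta * B by rewrite ler_pM2l//; lra.
by rewrite /c; lra.
Qed.

(** * Bounds for the static problem at the origin *)

(** A narrow parabola centred at 0 yields [lambda * u 0 <= lambda * u z <= - G <= |z| < e]. *)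
Lemma static_at0_le (lambda : R) (G : R -> R -> R) (u : R -> R) :
  0 < lambda -> (forall x p, - slowpot x <= G x p) ->
  static_solution lambda G u -> u 0 <= 0.
Proof.
move=> l0 HG [[cu sub _] [[M uM] _]].
have {}cu : continuous u by move=> x; exact: cu.
rewrite -(pmulr_rle0 _ l0).
apply/ler_addgt0Pr => e e0; rewrite add0r.
have M0 : 0 <= M by apply: le_trans (uM 0 I); exact: normr_ge0.
pose eta := (2 * M + 1) / e ^+ 2.
have eta0 : 0 < eta by rewrite divr_gt0// ?exprn_gt0//; lra.
have etae : eta * e ^+ 2 = 2 * M + 1 by rewrite /eta divfK// gt_eqF// exprn_gt0.
have eM : 2 * M < eta * e ^+ 2 by rewrite etae; lra.
have [z [zM uz zmax]] :=
  parabola_touching e0 eta0 eM (fun x (_ : 0 - e <= x <= 0 + e) => uM x I) cu.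
have [C1 D1] := parabola_C1 eta 0.
have := sub _ z C1 I zmax.
have := HG z ('D_1 (parabola eta 0) z).
have := slowpot_le_norm z.
have : `|z| < e.
  rewrite -ltr_sqr ?qualifE/= ?normr_ge0 ?ltW// real_normK ?num_real//.
  by rewrite -(ltr_pM2l eta0) etae; move: zM; rewrite subr0; lra.
have : u 0 <= u z.
  by apply: le_trans uz _; rewrite lerBlDr lerDl mulr_ge0 ?sqr_ge0// ltW.
rewrite -(ler_pM2l l0); lra.
Qed.

Lemma static_at0_ge (lambda : R) (G : R -> R -> R) (u : R -> R) (m : R) :
  0 < lambda -> (forall x p, G x p <= 2^-1 * p ^+ 2 - m) ->
  static_solution lambda G u -> m <= lambda * u 0.
Proof.
move=> l0 HG [[cu _ sup] [[M uM] _]].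
have {}cu : continuous u by move=> x; exact: cu.
apply/ler_addgt0Pr => e e0.
have M0 : 0 <= M by apply: le_trans (uM 0 I); exact: normr_ge0.
(* Flat enough that half the squared slope at contact is at most [4 * M * eta < e]. *)
pose eta := e / (4 * M + 1).
have eta0 : 0 < eta by rewrite divr_gt0//; lra.
have etae : eta * (4 * M + 1) = e by rewrite /eta divfK// gt_eqF//; lra.
(* A flat parabola needs a wide interval: [(q + 1) ^+ 2 > q] with [q = 2 * M / eta]. *)
pose r := 2 * M / eta + 1.
have Mz : 0 <= 2 * M / eta by apply: divr_ge0; [lra|exact: ltW].
have r0 : 0 < r by rewrite /r; lra.
have rM : 2 * M < eta * r ^+ 2.
  have -> : 2 * M = eta * (2 * M / eta) by rewrite [RHS]mulrC divfK// gt_eqF.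
  rewrite ltr_pM2l// /r; nra.
have uM' x : 0 - r <= x <= 0 + r -> `|(- u x)| <= M.
  by move=> _; rewrite normrN; exact: uM.
have cu' : continuous (fun x => - u x) by move=> x; apply: cvgN; exact: cu.
have [z [zM uz zmax]] := parabola_touching r0 eta0 rM uM' cu'.
have [C1 D1] := parabola_C1 eta 0.
set phi := parabola _ _ in C1 D1 zmax uz.
have [C1' dphi] := C1_onN setT C1.
have zmin : \forall w \near z, u z - - phi z <= u w - - phi w.
  by apply: filterS zmax => w; lra.
have := sup _ z C1' I zmin; rewrite dphi D1.
have := HG z (- (2 * eta * (z - 0))).
have -> : 2^-1 * (- (2 * eta * (z - 0))) ^+ 2 = 2 * eta * (eta * (z - 0) ^+ 2).
  by field.
have : 2 * eta * (eta * (z - 0) ^+ 2) <= 2 * eta * (2 * M).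
  by rewrite ler_pM2l//; lra.
have : u z <= u 0.
  have : 0 <= phi z by rewrite mulr_ge0 ?sqr_ge0// ltW.
  by lra.
rewrite -(ler_pM2l l0); lra.
Qed.

End HamiltonJacobiBounds.

Theorem proposition4p3 (R : realType) (Hbar : R -> R -> R)
    (hHbar : is_effective_hamiltonian (@hamiltonian R) Hbar) :
  (forall (eps : R) (ueps u : R * R -> R),
      0 < eps < 1 ->
      cauchy_solution (fun x p => hamiltonian x (x / eps) p) ueps ->
      cauchy_solution Hbar u ->
      forall t : R, 0 < t ->
        ueps (0, t) - u (0, t) >= 2^-1 * eps * t) /\
  (forall (lambda eps : R) (ueps u : R -> R),
      0 < lambda < 1 -> 0 < eps < 1 ->
      static_solution lambda (fun x p => hamiltonian x (x / eps) p) ueps ->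
      static_solution lambda Hbar u ->
      ueps 0 - u 0 >= eps / (2 * lambda)).
Proof.
have Hbar_ge x p := effective_hamiltonian_ge x p hHbar.
have H_le (eps x p : R) : 0 < eps < 1 ->
    hamiltonian x (x / eps) p <= 2^-1 * p ^+ 2 - eps / 2.
  by move=> /(potential_ge x); rewrite /hamiltonian; lra.
split=> [eps ueps u e01 sueps su t t0|lambda eps ueps u /andP[l0 _] e01 sueps su].
  have := cauchy_at0_le Hbar_ge su t0.
  have := cauchy_at0_ge (fun x p => H_le eps x p e01) sueps t0.
  by lra.
have := static_at0_le l0 Hbar_ge su.
have := static_at0_ge l0 (fun x p => H_le eps x p e01) sueps.
(* Multiplying by [lambda] reduces the claim to the bounds [eps / 2 <= lambda * ueps 0] and
   [u 0 <= 0]. *)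
rewrite -(ler_pM2l l0 (eps / (2 * lambda))).
have -> : lambda * (eps / (2 * lambda)) = eps / 2 by field; rewrite gt_eqF.
rewrite -(ler_pM2l l0 (u 0)) mulr0; lra.
Qed.
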